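(* Suppose that $m=1$, $\varepsilon=0$, and let $\Sigma_{\mathrm{pk}}\subseteq\Sigma_{\mathrm{cont}}$ be nonempty and open in $\Sigma$. Let $T\in\mathbb{N}$. Then an input $u_{[0,T-1]}\in\mathbb{R}^{T}$ is $\Sigma_{\mathrm{pk}}$-universal for identification if and only if it is persistently exciting of order $n+1$.
   Context: Let $n,m\in\mathbb{N}$, $\varepsilon\ge 0$, and $\Sigma=\mathbb{R}^{n\times n}\times\mathbb{R}^{n\times m}$. $\Sigma_{\mathrm{cont}}\subseteq\Sigma$ is the set of controllable pairs. A signal $u(0),\dots,u(T-1)\in\mathbb{R}^m$ is identified with the stacked vector $u_{[0,T-1]}\in\mathbb{R}^{mT}$; similarly for $x_{[0,T]}$. For $T\in\mathbb{N}$ and $(A,B)\in\Sigma$, $\mathfrak{B}_T(A,B)$ is the set of all pairs $(u_{[0,T-1]},x_{[0,T]})$, with $u(t)\in\mathbb{R}^m$, $x(t)\in\mathbb{R}^n$, for which there exist $w(0),\dots,w(T-1)\in\mathbb{R}^n$ with $\|w(t)\|\le\varepsilon$ (Euclidean norm) and $x(t+1)=Ax(t)+Bu(t)+w(t)$ for $t=0,\dots,T-1$. (For $\varepsilon=0$ this means $x(t+1)=Ax(t)+Bu(t)$; the initial state is free.) $\mathfrak{B}(A,B,u_{[0,T-1]})$ is the set of those elements of $\mathfrak{B}_T(A,B)$ whose input part equals the given $u_{[0,T-1]}$. For a dataset $\mathcal{D}$, $\Sigma_{\mathcal{D}}=\{(A,B)\in\Sigma\mid \mathcal{D}\in\mathfrak{B}_T(A,B)\}$.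 Let $\Sigma_{\mathrm{pk}}\subseteq\Sigma$ be the prior knowledge set. A dataset $\mathcal{D}\in\mathfrak{B}_T(A,B)$ with $(A,B)\in\Sigma_{\mathrm{pk}}$ is $\Sigma_{\mathrm{pk}}$-informative for identification if $\Sigma_{\mathcal{D}}\cap\Sigma_{\mathrm{pk}}$ is a singleton. An input $u_{[0,T-1]}$ is $\Sigma_{\mathrm{pk}}$-universal for identification if every $\mathcal{D}\in\bigcup_{(A,B)\in\Sigma_{\mathrm{pk}}}\mathfrak{B}(A,B,u_{[0,T-1]})$ is $\Sigma_{\mathrm{pk}}$-informative for identification. For $1\le k\le T$, the Hankel matrix of depth $k$ of $u_{[0,T-1]}$ is the $mk\times(T-k+1)$ matrix $\mathcal{H}_k(u_{[0,T-1]})$ whose $j$-th column ($j=0,\dots,T-k$) is the stacked vector of $u(j),\dots,u(j+k-1)$. The input is persistently exciting of order $k$ if $k\le T$ and $\mathcal{H}_k(u_{[0,T-1]})$ has full row rank. *)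

(* Defs.v *)
From HB Require Import structures.
From mathcomp Require Import all_boot all_order all_algebra.
From mathcomp Require Import all_classical all_reals all_analysis.
Set Implicit Arguments.
Unset Strict Implicit.
Unset Printing Implicit Defensive.
Import Order.TTheory GRing.Theory Num.Theory.
Import numFieldNormedType.Exports.
Local Open Scope classical_set_scope.
Local Open Scope ring_scope.

(* As a product of matrix types, [system R n m] carries the product topology,
   i.e. the usual topology of R^(n x n) x R^(n x m). *)
Definition system (R : realType) (n m : nat) : Type :=
  ('M[R]_(n, n) * 'M[R]_(n, m))%type.

Definition input (R : realType) (m T : nat) : Type := 'I_T -> 'cV[R]_m.

(* (u(0), ..., u(T-1)) and (x(0), ..., x(T)) *)
Definition dataset (R : realType) (n m T : nat) : Type :=
  (input R m T * ('I_T.+1 -> 'cV[R]_n))%type.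

(* The norm of the library on matrices is the max norm, hence this one. *)
Definition euclidean_norm (R : realType) (n : nat) (w : 'cV[R]_n) : R :=
  Num.sqrt (\sum_(i < n) w i 0 ^+ 2).

(* In [behavior], [widen_ord (leqnSn T) t] and [lift ord0 t] are the times t
   and t+1 in {0, ..., T}. *)
Definition behavior (R : realType) (n m : nat) (eps : R) (T : nat)
    (S : system R n m) : set (dataset R n m T) :=
  [set D | exists w : 'I_T -> 'cV[R]_n,
     forall t : 'I_T,
       euclidean_norm (w t) <= eps /\
       D.2 (lift ord0 t) =
         S.1 *m D.2 (widen_ord (leqnSn T) t) + S.2 *m D.1 t + w t].

Definition behavior_input (R : realType) (n m : nat) (eps : R) (T : nat)
    (S : system R n m) (u : input R m T) : set (dataset R n m T) :=
  [set D | behavior eps S D /\ D.1 = u].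

Definition consistent_systems (R : realType) (n m : nat) (eps : R) (T : nat)
    (D : dataset R n m T) : set (system R n m) :=
  [set S | behavior eps S D].

(* (A, B) is controllable when x(t+1) = A x(t) + B u(t) can be steered from any
   state to any other one in finite time. *)
Definition controllable (R : realType) (n m : nat) : set (system R n m) :=
  [set S | forall x0 x1 : 'cV[R]_n,
     exists (T : nat) (D : dataset R n m T),
       [/\ behavior 0 S D, D.2 ord0 = x0 & D.2 ord_max = x1]].

Definition informative (R : realType) (n m : nat) (eps : R)
    (Spk : set (system R n m)) (T : nat) (D : dataset R n m T) : Prop :=
  exists S : system R n m, consistent_systems eps D `&` Spk = [set S].

Definition universal (R : realType) (n m : nat) (eps : R)
    (Spk : set (system R n m)) (T : nat) (u : input R m T) : Prop :=
  forall D : dataset R n m T,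
    (\bigcup_(S in Spk) behavior_input eps S u) D -> informative eps Spk D.

Lemma hankel_index_subproof (k T : nat) (hk : (k <= T)%N)
    (j : 'I_(T - k).+1) (i : 'I_k) : (j + i < T)%N.
Proof.
have hj : (j <= T - k)%N by rewrite -ltnS.
by rewrite -addnS -[leqRHS](subnK hk) leq_add.
Qed.

Definition hankel_index (k T : nat) (hk : (k <= T)%N)
    (j : 'I_(T - k).+1) (i : 'I_k) : 'I_T :=
  Ordinal (hankel_index_subproof hk j i).

(* [mxvec] concatenates the rows u(j)^T, ..., u(j+k-1)^T, so that the j-th
   column is u(j), ..., u(j+k-1) stacked in this order. *)
Definition hankel (R : realType) (m k T : nat) (hk : (k <= T)%N)
    (u : input R m T) : 'M[R]_(k * m, (T - k).+1) :=
  \matrix_(r < k * m, j < (T - k).+1)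
    mxvec (\matrix_(i < k, p < m) u (hankel_index hk j i) p 0) 0 r.

Definition persistently_exciting (R : realType) (m k T : nat)
    (u : input R m T) : Prop :=
  exists hk : (k <= T)%N, row_free (hankel hk u).

(* Main.v *)
Require Import Defs.
From HB Require Import structures.
From mathcomp Require Import all_boot all_order all_algebra.
From mathcomp Require Import all_classical all_reals all_analysis.
From mathcomp Require Import polyXY.
Import Order.TTheory GRing.Theory Num.Theory.
Import numFieldNormedType.Exports.
Local Open Scope classical_set_scope.
Local Open Scope ring_scope.

(** The proof turns on a flat output of a controllable pair (A, B): a row e with
e A^k B = 0 for k < N - 1 and e A^(N-1) B = 1, where N is the dimension of the
state.  Put l(t) = e x(t).  Because the input needs N steps to reach l, the
values l(t), ..., l(t+N-1) are coordinates of the state x(t), and l(t+N) brings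
in u(t) on top.  Hence every linear functional y(t) = xi x(t) + eta u(t) of state
and input is c(sigma) l, where sigma is the time shift and c a polynomial of
degree at most N, namely the one with xi = e c(A) and eta = c_N
([flat_functional], [functional_flat]).  In particular u = a(sigma) l for some
such a.  On the other side, persistency of excitation of order N + 1 says that
no nonzero c of degree at most N satisfies c(sigma) u = 0 on the horizon
([persistently_exciting_annihilator]).

Sufficiency.  If two systems explain the same data, each row of their difference
is a functional y = c(sigma) l that vanishes along the data.  Then
c(sigma) u = c(sigma) a(sigma) l = a(sigma) y = 0, so c = 0, and the two systems
agree ([exciting_full_rank]).

Necessity.  Let c be nonzero with c(sigma) u = 0.  If c(A) is invertible, the
initial state can be chosen such that z = c(sigma) x starts at 0.  As z is a
state trajectory driven by the input c(sigma) u, it stays at 0 as long as this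
input is known to vanish, and e z stays at 0 for N - 1 steps more, because of the
delay between input and flat output.  So y = e z vanishes on the whole horizon:
the data satisfy the relation e c(A) x(t) + c_N u(t) = 0
([annihilated_rank_drop]).  Adding small multiples of this relation to the rows
of the system gives other systems with the same data, and they are still in the
open set of prior knowledge ([rank_drop_uninformative]).  Invertibility of c(A)
is free: replacing A by A + d I with d small stays inside the open set, and
c(A + d I) is singular for finitely many d only ([shift_unit_poly]). *)

(** * Trajectories on an unbounded horizon *)

Definition trajectory {F : fieldType} {n} (A : 'M[F]_n) (B : 'cV[F]_n)
    (u : nat -> F) (x : nat -> 'cV[F]_n) : Prop :=
  forall t, x t.+1 = A *m x t + u t *: B.

Fixpoint response {F : fieldType} {n} (A : 'M[F]_n) (B : 'cV[F]_n)
    (u : nat -> F) (x0 : 'cV[F]_n) (t : nat) : 'cV[F]_n :=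
  if t is t'.+1 then A *m response A B u x0 t' + u t' *: B else x0.

Lemma response_free {F : fieldType} {n} (A : 'M[F]_n.+1) (B : 'cV[F]_n.+1) u x0 t :
  response A B u x0 t = A ^+ t *m x0 + response A B u 0 t.
Proof.
elim: t => [|t IH] /=; first by rewrite expr0 mul1mx addr0.
by rewrite IH mulmxDr mulmxA exprS addrA.
Qed.

(** * Flat outputs *)

(** The dimension of the state is n + 1, so that square matrices form a ring. *)
Definition flat_output {F : fieldType} {n} (A : 'M[F]_n.+1) (B : 'cV[F]_n.+1)
    (e : 'rV[F]_n.+1) : Prop :=
  forall k, (k <= n)%N -> e *m A ^+ k *m B = (k == n)%:R%:M.

Lemma horner_mx_wide {F : fieldType} {n} (A : 'M[F]_n.+1) N (c : {poly F}) :
  (size c <= N)%N -> horner_mx A c = \sum_(k < N) c`_k *: A ^+ k.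
Proof.
move=> szc; rewrite /horner_mx /horner_morph /=.
rewrite (@horner_coef_wide _ N); last by rewrite (leq_trans (size_poly _ _)).
by apply: eq_bigr => k _; rewrite coef_map /= -mulmxE mul_scalar_mx.
Qed.

(** The input needs n + 1 steps to reach the flat output; before that, the future
values of the flat output are functions of the present state alone. *)
Lemma flat_shift {F : fieldType} {n} {A : 'M[F]_n.+1} {B e u x} :
  flat_output A B e -> trajectory A B u x ->
  forall t k, (k <= n)%N -> e *m x (t + k)%N = e *m A ^+ k *m x t.
Proof.
move=> fe tx t k; elim: k t => [|k IH] t le_kn.
  by rewrite addn0 expr0 mulmx1.
rewrite addnS -addSn IH ?(ltnW le_kn) // tx mulmxDr -scalemxAr fe ?(ltnW le_kn) //.
rewrite (ltn_eqF le_kn) scale_scalar_mx mulr0 raddf0 addr0 exprSr.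
by rewrite !mulmxA.
Qed.

Lemma flat_shift_top {F : fieldType} {n} {A : 'M[F]_n.+1} {B e u x} :
  flat_output A B e -> trajectory A B u x ->
  forall t, e *m x (t + n.+1)%N = e *m A ^+ n.+1 *m x t + (u t)%:M.
Proof.
move=> fe tx t; rewrite addnS -addSn (flat_shift fe tx) // tx mulmxDr -scalemxAr.
by rewrite fe // eqxx scale_scalar_mx mulr1 exprSr !mulmxA.
Qed.

Lemma flat_functional {F : fieldType} {n} {A : 'M[F]_n.+1} {B e u x} :
  flat_output A B e -> trajectory A B u x ->
  forall (c : {poly F}) t, (size c <= n.+2)%N ->
  e *m horner_mx A c *m x t + (c`_n.+1 * u t)%:M
    = \sum_(k < n.+2) c`_k *: (e *m x (t + k)%N).
Proof.
move=> fe tx c t szc; rewrite (horner_mx_wide _ _ _ szc) mulmx_sumr mulmx_suml.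
rewrite [in LHS]big_ord_recr [in RHS]big_ord_recr /= (flat_shift_top fe tx).
rewrite scalerDr scale_scalar_mx addrA -scalemxAr -scalemxAl; congr (_ + _ + _).
apply: eq_bigr => k _.
by rewrite (flat_shift fe tx) -?scalemxAr -?scalemxAl // -ltnS.
Qed.

(** The rows e A^k, multiplied by the columns B, A B, ..., A^n B in reverse order,
give a triangular matrix with ones on its diagonal. *)
Lemma flat_basis {F : fieldType} {n} {A : 'M[F]_n.+1} {B e} :
  flat_output A B e -> (\matrix_(k < n.+1) (e *m A ^+ k)) \in unitmx.
Proof.
move=> fe; set O := (X in X \in _).
pose C := \matrix_(i < n.+1, j < n.+1) (A ^+ (n - j) *m B) i 0.
have OC k j : (O *m C) k j = (e *m A ^+ (k + (n - j)) *m B) 0 0.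
  rewrite exprD -mulmxE !mulmxA -mulmxA !mxE.
  by apply: eq_bigr => i _; rewrite !mxE.
suff: O *m C \in unitmx by rewrite unitmx_mul => /andP[].
rewrite unitmxE det_trig.
  rewrite big1 ?unitr1 // => i _.
  have lei: (i <= n)%N by rewrite -ltnS.
  by rewrite OC subnKC // fe // eqxx mxE.
apply/is_trig_mxP => i j lt_ij; rewrite OC.
have lej: (j <= n)%N by rewrite -ltnS.
have lt_n: (i + (n - j) < n)%N by rewrite addnC -ltn_subRL subKn.
by rewrite fe ?(ltnW lt_n) // (ltn_eqF lt_n) mxE.
Qed.

(** Converse of [flat_functional]: the coefficient of degree n + 1 of c takes care
of eta, and the lower ones are the coordinates of xi - eta e A^(n+1) in the basis
of [flat_basis]. *)
Lemma functional_flat {F : fieldType} {n} {A : 'M[F]_n.+1} {B e} :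
  flat_output A B e -> forall (xi : 'rV[F]_n.+1) (eta : F),
  exists c : {poly F},
    [/\ (size c <= n.+2)%N, e *m horner_mx A c = xi & c`_n.+1 = eta].
Proof.
move=> fe xi eta; have Ou := flat_basis fe; set O := (X in X \in _) in Ou.
pose s := (xi - eta *: (e *m A ^+ n.+1)) *m invmx O.
pose c := \poly_(k < n.+2) (if insub k is Some i then s 0 i else eta).
have szc : (size c <= n.+2)%N by exact: size_poly.
have ctop : c`_n.+1 = eta by rewrite coef_poly ltnSn insubF ?ltnn.
exists c; split=> //.
rewrite (horner_mx_wide _ _ _ szc) mulmx_sumr big_ord_recr /= ctop.
rewrite -[RHS](subrK (eta *: (e *m A ^+ n.+1))) -scalemxAr; congr (_ + _).
rewrite -[RHS](mulmxKV Ou) mulmx_sum_row; apply: eq_bigr => k _.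
by rewrite rowK coef_poly (ltn_trans (ltn_ord k)) // (valK k) -scalemxAr.
Qed.

Lemma krylov_functional {F : fieldType} {n} (A : 'M[F]_n.+1) (B : 'cV[F]_n.+1)
    (v : 'rV[F]_n.+1) :
  (forall k, (k <= n)%N -> v *m A ^+ k *m B = 0) ->
  forall k, v *m A ^+ k *m B = 0.
Proof.
move=> v0 k.
suff: v *m horner_mx A 'X^k *m B = 0 by rewrite rmorphXn /= horner_mx_X.
rewrite (divp_eq 'X^k (char_poly A)) rmorphD rmorphM /= Cayley_Hamilton mulr0 add0r.
rewrite (@horner_mx_wide _ _ A n.+1); last first.
  rewrite -ltnS -(size_char_poly A) ltn_modp.
  by rewrite -size_poly_gt0 size_char_poly.
rewrite mulmx_sumr mulmx_suml big1 // => i _.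
by rewrite -scalemxAr -scalemxAl v0 ?scaler0 // -ltnS.
Qed.

(** The hypothesis is the dual form of reachability.  It makes the matrix with
columns B, A B, ..., A^n B invertible, and e is the last row of its inverse. *)
Lemma flat_output_exists {F : fieldType} {n} (A : 'M[F]_n.+1) (B : 'cV[F]_n.+1) :
  (forall v : 'rV[F]_n.+1, (forall k, v *m A ^+ k *m B = 0) -> v = 0) ->
  exists e, flat_output A B e.
Proof.
move=> ctrl; pose C := \matrix_(i < n.+1, k < n.+1) (A ^+ k *m B) i 0.
have vC (v : 'rV_n.+1) (k : 'I_n.+1) : (v *m C) 0 k = (v *m A ^+ k *m B) 0 0.
  by rewrite -mulmxA !mxE; apply: eq_bigr => i _; rewrite mxE.
have Cu : C \in unitmx.
  rewrite -row_free_unit -kermx_eq0; apply/rowV0P => v /sub_kermxP vC0.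
  apply: ctrl; apply: krylov_functional => k le_kn.
  apply/matrixP => i j; rewrite !ord1 -(vC v (Ordinal (n:=n.+1) le_kn)) vC0.
  by rewrite !mxE.
exists (delta_mx 0 ord_max *m invmx C) => k le_kn.
apply/matrixP => i j; rewrite !ord1 -(vC _ (Ordinal (n:=n.+1) le_kn)) mulmxKV //.
by rewrite !mxE /= mulr1n.
Qed.

(** * Excitation along trajectories *)

(** The relation c(sigma) u = 0, at all times where it involves only the values
u(0), ..., u(T-1). *)
Definition annihilates {F : fieldType} (N T : nat) (c : {poly F})
    (u : nat -> F) : Prop :=
  forall t, (t + N < T)%N -> \sum_(k < N.+1) c`_k * u (t + k)%N = 0.

(** Under excitation, no relation xi x + eta u = 0 holds along the data: applying
a(sigma) to y = c(sigma) l, where u = a(sigma) l, gives c(sigma) u = 0. *)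
Lemma exciting_full_rank {F : fieldType} {n} {A : 'M[F]_n.+1} {B e u x} T :
  flat_output A B e -> trajectory A B u x ->
  (forall c : {poly F}, (size c <= n.+2)%N -> annihilates n.+1 T c u -> c = 0) ->
  forall (xi : 'rV[F]_n.+1) (eta : F),
  (forall t, (t < T)%N -> xi *m x t + (eta * u t)%:M = 0) -> xi = 0 /\ eta = 0.
Proof.
move=> fe tx exc xi eta xi0.
have [c [szc cxi ceta]] := functional_flat fe xi eta.
have [a [sza a0 a1]] := functional_flat fe 0 1.
suff c0: c = 0.
  by rewrite -cxi -ceta c0 rmorph0 mulmx0 coef0.
apply: exc => // t ltT.
have uE s : (u s)%:M = \sum_(i < n.+2) a`_i *: (e *m x (s + i)%N).
  by rewrite -(flat_functional fe tx) // a0 a1 mul0mx add0r mul1r.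
suff: (\sum_(k < n.+2) c`_k * u (t + k)%N)%:M = 0 :> 'M[F]_1.
  by move/matrixP/(_ 0 0); rewrite !mxE eqxx.
rewrite raddf_sum /=.
under eq_bigr => k _ do rewrite -scale_scalar_mx uE scaler_sumr.
rewrite exchange_big big1 //= => i _.
under eq_bigr => k _ do rewrite scalerA mulrC -scalerA addnAC.
rewrite -scaler_sumr -(flat_functional fe tx) // cxi ceta xi0 ?scaler0 //.
by rewrite (leq_trans _ ltT) // ltnS leq_add2l -ltnS.
Qed.

(** For c(sigma) u = 0, the trajectory z = c(sigma) x can be started at 0 as soon as
c(A) is invertible, and then y = c(sigma) l = e z vanishes up to time T - 1. *)
Lemma annihilated_rank_drop {F : fieldType} {n} {A : 'M[F]_n.+1} {B e} u T
    (c : {poly F}) :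
  flat_output A B e -> (size c <= n.+2)%N -> annihilates n.+1 T c u ->
  horner_mx A c \in unitmx ->
  exists x0, forall t, (t < T)%N ->
    e *m horner_mx A c *m response A B u x0 t + (c`_n.+1 * u t)%:M = 0.
Proof.
move=> fe szc annc cu.
pose z0 := \sum_(k < n.+2) c`_k *: response A B u 0 k.
pose x0 := - (invmx (horner_mx A c) *m z0); exists x0 => t ltT.
set x := response A B u x0.
pose z s := \sum_(k < n.+2) c`_k *: x (s + k)%N.
pose v s := \sum_(k < n.+2) c`_k * u (s + k)%N.
have tx : trajectory A B u x by [].
have tz : trajectory A B v z.
  move=> s; rewrite /z /v mulmx_sumr scaler_suml -big_split /=.
  by apply: eq_bigr => k _; rewrite addSn tx scalerDr -scalemxAr scalerA.
have z00 : z 0%N = 0.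
  rewrite /z; under eq_bigr => k _ do rewrite add0n /x response_free scalerDr.
  rewrite big_split /= -/z0.
  under eq_bigr => k _ do rewrite scalemxAl.
  by rewrite -mulmx_suml -horner_mx_wide // mulmxN mulKVmx // addNr.
have zs0 s : (s <= T - n.+1)%N -> z s = 0.
  elim: s => // s IH les; rewrite tz IH ?(ltnW les) // mulmx0 add0r.
  by rewrite /v annc ?scale0r // -ltn_subRL -subn_gt0 subnAC subn_gt0.
rewrite (flat_functional fe tx) //.
transitivity (e *m z t).
  by rewrite mulmx_sumr; apply: eq_bigr => k _; rewrite scalemxAr.
(* Past the last time T - (n + 1) where z is known to vanish, at most n steps
   remain, too few for the input to reach e z. *)
have [/zs0 -> | lt_t] := leqP t (T - n.+1); first by rewrite mulmx0.
rewrite -(subnKC (ltnW lt_t)) (flat_shift fe tz) ?zs0 ?mulmx0 //.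
by rewrite leq_subLR -ltnS -addnS (leq_trans ltT) // addnC -leq_subLR.
Qed.

(** * Small perturbations of a system *)

Lemma horner_mx_shift {F : fieldType} {n} (A : 'M[F]_n.+1) d (c : {poly F}) :
  horner_mx A (c \Po ('X + d%:P)) = horner_mx (A + d%:M) c.
Proof.
elim/poly_ind: c => [|c a IH]; first by rewrite comp_poly0 !rmorph0.
rewrite comp_polyD comp_polyM comp_polyX comp_polyC !rmorphD !rmorphM /= IH.
by rewrite rmorphD /= !horner_mx_X !horner_mx_C.
Qed.

(** The polynomial s is the resultant of c(X + Y) and the characteristic polynomial
chi of A with respect to X.  A Bezout identity s(Y) = p c(X + Y) + q chi(X),
evaluated at X = A and Y = d, becomes s(d) I = p(A, d) c(A + d I) by
Cayley-Hamilton. *)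
Lemma shift_unit_poly {F : fieldType} {n} (A : 'M[F]_n.+1) (c : {poly F}) :
  c != 0 -> exists2 s : {poly F}, s != 0 &
    forall d, s.[d] != 0 -> horner_mx (A + d%:M) c \in unitmx.
Proof.
move=> c0; have [szc|szc] := leqP (size c) 1.
  exists 1 => [|d _]; first exact: oner_neq0.
  move: c0; rewrite (size1_polyC szc) polyC_eq0 horner_mx_C => c0.
  by rewrite unitmxE det_scalar unitrX // unitfE.
have sza : (1 < size (char_poly A))%N by rewrite size_char_poly.
have a0 : char_poly A != 0 by rewrite -size_poly_gt0 size_char_poly.
exists (sub_annihilant c (char_poly A)); first exact: sub_annihilant_neq0.
move=> d sd; have := @resultant_in_ideal _ (poly_XaY c) (char_poly A)^:P.
rewrite size_poly_XaY size_map_polyC => /(_ szc sza)[[p q] _ /=].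
rewrite -/(sub_annihilant c _) => /(congr1 (map_poly (horner_eval d))).
rewrite map_polyC rmorphD !rmorphM /= -map_poly_comp.
rewrite (@eq_map_poly _ _ _ id) ?map_poly_id //; last first.
  by move=> a; rewrite /= /horner_eval hornerC.
rewrite /poly_XaY map_comp_poly -map_poly_comp (@eq_map_poly _ _ _ id); last first.
  by move=> a; rewrite /= /horner_eval hornerC.
rewrite map_poly_id // rmorphD /= map_polyX map_polyC /= /horner_eval hornerX.
move/(congr1 (horner_mx A)); rewrite rmorphD !rmorphM /= Cayley_Hamilton mulr0.
rewrite addr0 horner_mx_C horner_mx_shift => E.
have: (sub_annihilant c (char_poly A)).[d]%:M \in @unitmx F n.+1.
  by rewrite unitmxE det_scalar unitrX // unitfE.
by rewrite E -mulmxE unitmx_mul => /andP[].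
Qed.

Lemma small_nonroot {R : realFieldType} (p : {poly R}) (r : R) :
  p != 0 -> 0 < r -> exists s, [/\ 0 < s, s < r & p.[s] != 0].
Proof.
move=> p0 r0; apply: contrapT => allroot.
(* More roots in ]0, r[ than the degree allows. *)
pose f (k : nat) := r / k.+2%:R.
have fr k : root p (f k).
  apply/negP => pfk; apply: allroot; exists (f k); split=> //.
    by rewrite divr_gt0 // ltr0n.
    by rewrite ltr_pdivrMr ?ltr0n // ltr_pMr // ltr1n.
  exact/negP.
have finj : injective f.
  move=> a b fab; have /invr_inj/eqP := mulfI (lt0r_neq0 r0) fab.
  by rewrite eqr_nat => /eqP [].
have := @max_poly_roots _ p (map f (iota 0 (size p))) p0.
rewrite size_map size_iota ltnn (map_inj_uniq finj) iota_uniq.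
have -> : all (root p) (map f (iota 0 (size p))).
  by apply/allP => _ /mapP[k _ ->].
by move=> /(_ isT isT).
Qed.

(** The nonzero polynomial p encodes finitely many values of s to be avoided. *)
Lemma open_perturbation {R : realType} {n m : nat} {U : set (system R n m)}
    {S : system R n m} (D : system R n m) (p : {poly R}) :
  open U -> U S -> p != 0 ->
  exists s : R, [/\ s != 0, p.[s] != 0 & U (S.1 + s *: D.1, S.2 + s *: D.2)].
Proof.
case: S D => [A B] [dA dB] /= oU US p0.
have line (k l : nat) (X Y : 'M[R]_(k, l)) : X + s *: Y @[s --> (0 : R)] --> X.
  have : X + s *: Y @[s --> (0 : R)] --> X + (0 : R) *: Y.
    by apply: cvgD; [exact: cvg_cst|apply: cvgZr_tmp; exact: cvg_id].
  by rewrite scale0r addr0.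
have : \forall s \near (0 : R), U (A + s *: dA, B + s *: dB).
  have := cvg_pair (line _ _ A dA) (line _ _ B dB).
  by apply; exact: (@open_nbhs_nbhs _ (A, B) U (conj oU US)).
move=> /nbhs_ballP[r /= r0 rU].
have [s [s0 sr ps]] := small_nonroot _ _ p0 r0.
exists s; split=> //; first by rewrite gt_eqF.
by apply: rU; rewrite /ball /= sub0r normrN gtr0_norm.
Qed.

(** * Data on the horizon T *)

(** Trajectories run for ever because the relations at the last times of the horizon
are expressed by later values of the flat output; the inputs after time T - 1, set
to 0, influence no state up to time T. *)
Definition extend {R : realType} {T : nat} (u : input R 1 T) (t : nat) : R :=
  if insub t is Some i then u i 0 0 else 0.

Lemma extendE {R : realType} {T : nat} (u : input R 1 T) (i : 'I_T) :
  extend u i = u i 0 0.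
Proof. by rewrite /extend valK. Qed.

Lemma noiseless_behavior {R : realType} {n T : nat} (S : system R n 1)
    (D : dataset R n 1 T) :
  behavior 0 S D <-> forall t : 'I_T,
    D.2 (lift ord0 t) =
      S.1 *m D.2 (widen_ord (leqnSn T) t) + extend D.1 t *: S.2.
Proof.
have inE t : S.2 *m D.1 t = extend D.1 t *: S.2.
  by rewrite extendE [D.1 t]mx11_scalar mul_mx_scalar mxE mulr1n.
split=> [[w wD] t|DE].
  have [w0 ->] := wD t; rewrite inE; suff -> : w t = 0 by rewrite addr0.
  move: w0; rewrite -sqrtr0 ler_sqrt // => w0.
  have w2 (j : 'I_n) : 0 <= w t j 0 ^+ 2 by exact: sqr_ge0.
  have /eqP : \sum_(j < n) w t j 0 ^+ 2 = 0.
    by apply/eqP; rewrite eq_le w0 sumr_ge0.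
  rewrite psumr_eq0 // => /allP w00; apply/matrixP => j k; rewrite ord1 mxE.
  by apply/eqP; rewrite -sqrf_eq0; apply: w00; rewrite mem_index_enum.
exists (fun=> 0) => t; rewrite inE addr0 DE; split=> //.
by rewrite /euclidean_norm big1 ?sqrtr0 // => j _; rewrite mxE expr0n.
Qed.

Lemma behavior_response {R : realType} {n T : nat} (S : system R n 1)
    (D : dataset R n 1 T) : behavior 0 S D ->
  forall t : 'I_T.+1, D.2 t = response S.1 S.2 (extend D.1) (D.2 ord0) t.
Proof.
move=> /noiseless_behavior DE [t]; elim: t => [|t IH] lt.
  by congr (D.2 _); apply: val_inj.
have lt' : (t < T)%N by [].
rewrite /= -(IH (ltnW lt)).
have -> : Ordinal lt = lift ord0 (Ordinal lt') by apply: val_inj.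
by rewrite DE; congr (_ *m D.2 _ + _); apply: val_inj.
Qed.

Lemma response_behavior {R : realType} {n T : nat} (S : system R n 1)
    (u : input R 1 T) (x0 : 'cV[R]_n) :
  behavior 0 S (u, fun t : 'I_T.+1 => response S.1 S.2 (extend u) x0 t).
Proof. by apply/noiseless_behavior => t. Qed.

(** A row v with v A^k B = 0 for all k annihilates every state reachable from 0,
hence also the state v^T. *)
Lemma controllable_flat {R : realType} {n : nat} (S : system R n.+1 1) :
  controllable S -> exists e, flat_output S.1 S.2 e.
Proof.
move=> ctrl; apply: flat_output_exists => v vAB.
have [T [D [DS D0 D1]]] := ctrl 0 v^T.
have vx u t k : v *m S.1 ^+ k *m response S.1 S.2 u 0 t = 0.
  elim: t k => [|t IH] k /=; first by rewrite mulmx0.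
  rewrite mulmxDr -scalemxAr vAB scaler0 addr0 mulmxA -(mulmxA v) mulmxE.
  by rewrite -exprSr IH.
have := vx (extend D.1) T 0%N; rewrite expr0 mulmx1.
rewrite -[T in response _ _ _ _ T]/(nat_of_ord (@ord_max T)) -D0.
rewrite -behavior_response // D1 => /matrixP/(_ 0 0); rewrite !mxE.
under eq_bigr => i _ do rewrite mxE -expr2.
move=> /eqP; rewrite psumr_eq0 => [/allP v0|i _]; last exact: sqr_ge0.
apply/matrixP => i j; rewrite ord1 mxE; apply/eqP; rewrite -sqrf_eq0.
by apply: v0; rewrite mem_index_enum.
Qed.

(** * Hankel matrices and annihilating polynomials *)

Lemma hankel_mulE {R : realType} {N T : nat} (hN : (N.+1 <= T)%N) (u : input R 1 T)
    (v : 'rV[R]_(N.+1 * 1)) (j : 'I_(T - N.+1).+1) :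
  (v *m hankel hN u) 0 j =
    \sum_(k < N.+1) vec_mx v k 0 * extend u (j + k)%N.
Proof.
rewrite mxE (reindex (fun k : 'I_N.+1 => mxvec_index k (0 : 'I_1))) /=.
  apply: eq_bigr => k _; rewrite !mxE mxvecE !mxE.
  by rewrite -[(j + k)%N]/(nat_of_ord (hankel_index hN j k)) extendE.
have [g gK Kg] := curry_mxvec_bij N.+1 1.
exists (fun i => (g i).1) => [k _|i _]; first by rewrite (gK (k, 0)).
by have := Kg i isT; case: (g i) => a b /=; rewrite (ord1 b).
Qed.

(** The left kernel of the Hankel matrix is the set of annihilators of u.  When
T <= N there is no Hankel matrix of depth N + 1, but then c = 1 annihilates u
vacuously, so that the equivalence holds in this case too. *)
Lemma persistently_exciting_annihilator {R : realType} {N T : nat} (u : input R 1 T) :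
  persistently_exciting N.+1 u <->
  forall c : {poly R}, (size c <= N.+1)%N -> annihilates N T c (extend u) -> c = 0.
Proof.
split=> [[hN /row_freeP[H' HH']] c szc annc|exc].
  pose v : 'rV[R]_(N.+1 * 1) := mxvec (\col_(k < N.+1) c`_k).
  suff v0 : v = 0.
    apply/polyP => k; rewrite coef0; have [ltk|lek] := ltnP k N.+1; last first.
      by rewrite nth_default // (leq_trans szc).
    have := congr1 vec_mx v0; rewrite mxvecK linear0 => /matrixP/(_ (Ordinal ltk) 0).
    by rewrite !mxE.
  rewrite -[v]mulmx1 -HH' mulmxA.
  suff -> : v *m hankel hN u = 0 by rewrite mul0mx.
  apply/matrixP => i j; rewrite ord1 hankel_mulE mxE -[RHS](annc j).
    by apply: eq_bigr => k _; rewrite mxvecK mxE.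
  by have := ltn_ord j; rewrite ltnS leq_subRL // addSn addnC.
have [hN|ltN] := leqP N.+1 T; last first.
  suff /eqP : (1 : {poly R}) = 0 by rewrite oner_eq0.
  apply: exc => [|t]; first by rewrite size_poly1.
  by rewrite ltnNge (leq_trans _ (leq_addl _ _)).
exists hN; rewrite -kermx_eq0; apply/rowV0P => v /sub_kermxP vH.
pose c := \poly_(k < N.+1) (vec_mx v (inord k) 0 : R).
have cE (k : 'I_N.+1) : c`_k = vec_mx v k 0.
  by rewrite coef_poly ltn_ord inord_val.
have c0 : c = 0.
  apply: exc => [|t ltT]; first exact: size_poly.
  have ltt : (t < (T - N.+1).+1)%N by rewrite ltnS leq_subRL // addnC addnS.
  have := hankel_mulE hN u v (Ordinal ltt); rewrite vH mxE => vu0; rewrite [RHS]vu0.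
  by apply: eq_bigr => k _; rewrite cE.
apply: (can_inj (@vec_mxK _ _ _)); apply/matrixP => k j.
by rewrite ord1 -cE c0 coef0 linear0 mxE.
Qed.

(** * Universal inputs *)

Lemma exciting_universal {R : realType} {n T : nat} (Spk : set (system R n.+1 1))
    (u : input R 1 T) :
  Spk `<=` @controllable R n.+1 1 -> persistently_exciting n.+2 u ->
  universal 0 Spk u.
Proof.
move=> ctrl /persistently_exciting_annihilator exc [v X] [S SpkS [/= DS vu]].
move: DS; rewrite {v}vu => DS.
have [e fe] := controllable_flat _ (ctrl _ SpkS).
exists S; apply/seteqP; split=> [S' [/= DS' _]|S' ->]; last by split.
pose x := response S.1 S.2 (extend u) (X ord0).
have tx : trajectory S.1 S.2 (extend u) x by [].
have xX (t : 'I_T.+1) : X t = x t := behavior_response _ _ DS t.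
have diff0 t : (t < T)%N -> (S'.1 - S.1) *m x t + extend u t *: (S'.2 - S.2) = 0.
  move=> ltT; pose i := Ordinal ltT.
  move/noiseless_behavior/(_ i) : DS'; move/noiseless_behavior/(_ i) : DS => /= ->.
  rewrite xX /= => /eqP; rewrite eq_sym -subr_eq0 opprD addrACA => /eqP E.
  by rewrite mulmxBl scalerBr.
have row0 (i : 'I_n.+1) : row i (S'.1 - S.1) = 0 /\ (S'.2 - S.2) i 0 = 0.
  apply: (exciting_full_rank T fe tx exc) => t ltT.
  have := congr1 (row i) (diff0 t ltT).
  rewrite linearD /= row_mul linearZ /= linear0 => <-; congr (_ + _).
  by apply/matrixP => a b; rewrite !ord1 !mxE mulr1n mulrC.
case: S' S {DS DS' SpkS fe tx xX x diff0} row0 => [A' B'] [A B] /= row0.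
congr (_, _); apply/eqP; rewrite -subr_eq0; apply/eqP.
  by apply/row_matrixP => i; rewrite (row0 i).1 linear0.
by apply/matrixP => i j; rewrite ord1 (row0 i).2 mxE.
Qed.

(** A relation xi x + eta u = 0 along the data of S makes S + s (1 xi, 1 eta) explain
the same data for every s, where 1 is the column of ones; by openness some
s <> 0 stays in the prior knowledge. *)
Lemma rank_drop_uninformative {R : realType} {n T : nat}
    (Spk : set (system R n.+1 1)) (S : system R n.+1 1) (u : input R 1 T) x0
    (xi : 'rV[R]_n.+1) (eta : R) :
  open Spk -> Spk S ->
  (forall t, (t < T)%N ->
    xi *m response S.1 S.2 (extend u) x0 t + (eta * extend u t)%:M = 0) ->
  universal 0 Spk u -> xi = 0 /\ eta = 0.
Proof.
move=> oS SpkS xi0 univ; pose x := response S.1 S.2 (extend u) x0.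
pose D : dataset R n.+1 1 T := (u, fun t : 'I_T.+1 => x t).
have DS : behavior 0 S D by exact: response_behavior.
have [|S1 ES1] := univ D; first by exists S.
pose one : 'cV[R]_n.+1 := const_mx 1.
have [s [s0 _ SpkS']] :=
  open_perturbation (one *m xi, eta *: one) 1 oS SpkS (oner_neq0 _).
set S' := (X in Spk X) in SpkS'.
have DS' : behavior 0 S' D.
  apply/noiseless_behavior => t /=; rewrite -[x t.+1]/(S.1 *m x t + extend u t *: S.2).
  rewrite mulmxDl scalerDr addrACA -[LHS]addr0; congr (_ + _).
  rewrite -scalemxAl -mulmxA.
  have /eqP := xi0 t (ltn_ord t); rewrite addr_eq0 => /eqP ->.
  rewrite mulmxN mul_mx_scalar scalerN !scalerA.
  by rewrite [extend u t * s]mulrC -(mulrA s) [extend u t * eta]mulrC addNr.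
have SS' : S' = S.
  have : (consistent_systems 0 D `&` Spk) S' by split.
  have : (consistent_systems 0 D `&` Spk) S by split.
  by rewrite ES1 => /= -> ->.
have /eqP := congr1 fst SS'; rewrite /= -subr_eq0 addrAC subrr add0r.
rewrite scaler_eq0 (negbTE s0) => /eqP onexi.
have /eqP := congr1 snd SS'; rewrite /= -subr_eq0 addrAC subrr add0r.
rewrite scaler_eq0 (negbTE s0) => /eqP oneeta.
split; last by move/matrixP/(_ 0 0) : oneeta; rewrite !mxE mulr1.
apply/matrixP => i j; rewrite ord1 mxE; move/matrixP/(_ 0 j) : onexi.
by rewrite mxE big_ord1 !mxE mul1r.
Qed.

Lemma universal_exciting {R : realType} {n T : nat} (Spk : set (system R n.+1 1))
    (u : input R 1 T) :
  Spk `<=` @controllable R n.+1 1 -> Spk !=set0 -> open Spk ->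
  universal 0 Spk u -> persistently_exciting n.+2 u.
Proof.
move=> ctrl [S0 SpkS0] oS univ; apply/persistently_exciting_annihilator => c szc annc.
apply/eqP; apply: contraT => c0.
have [p p0 pcu] := shift_unit_poly S0.1 c c0.
have [d [_ pd]] := open_perturbation (1%:M, 0) p oS SpkS0 p0.
set S := (X in Spk X) => SpkS.
have cu : horner_mx S.1 c \in unitmx by rewrite /= scalemx1; exact: pcu.
have [e fe] := controllable_flat _ (ctrl _ SpkS).
have [x0 drop] := annihilated_rank_drop _ T c fe szc annc cu.
have [ec0 _] := rank_drop_uninformative _ _ _ _ _ _ oS SpkS drop univ.
(* A zero relation would force e = 0, against e A^n B = 1. *)
have e0 : e = 0 by rewrite -(mulmxK cu e) ec0 mul0mx.
have /matrixP/(_ 0 0) := fe n (leqnn n).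
by rewrite e0 !mul0mx eqxx !mxE => /eqP; rewrite eq_sym oner_eq0.
Qed.

Theorem theorem7 (R : realType) (n : nat) (n_gt0 : (0 < n)%N)
    (Spk : set (system R n 1))
    (Spk_cont : Spk `<=` @controllable R n 1)
    (Spk_nonempty : Spk !=set0)
    (Spk_open : open Spk)
    (T : nat) (u : input R 1 T) :
  universal 0 Spk u <-> persistently_exciting n.+1 u.
Proof.
case: n n_gt0 Spk Spk_cont Spk_nonempty Spk_open => // n _ Spk ctrl ne op.
by split; [exact: universal_exciting|exact: exciting_universal].
Qed.
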